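(* Let $0<\mu<L_{\max}^{-1}$ with $L_{\max}=\max_i\|A_i\|_2^2$, let $\{x^n\}$ be generated by GAITA (as in the context) from an arbitrary $x^0\in\mathbf{R}^N$, and suppose $\{x^n\}$ converges to $x^*$. Let $I=Supp(x^* )$, $K=\|x^*\|_0$ and $e=\min_{i\in I}|x_i^*|$. Then $x^*$ is a strict local minimizer of $T_\lambda$ if either of the following holds: (a) $\lambda_{\min}(A_I^TA_I)>0$ and $0<\lambda<\frac{\lambda_{\min}(A_I^TA_I)\,e^{2-q}}{q(1-q)}$; (b) $\frac{\lambda_{\min}(A_I^TA_I)}{\max_i\|A_i\|_2^2}>\frac q2$ and $\frac{q}{2\lambda_{\min}(A_I^TA_I)}<\mu<\frac{1}{\max_i\|A_i\|_2^2}$.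
   Context: Let $A\in\mathbf{R}^{m\times N}$ have columns $A_1,\dots,A_N$, $y\in\mathbf{R}^m$, $\lambda>0$, $q\in(0,1)$, and $T_\lambda(x)=\frac12\|Ax-y\|_2^2+\lambda\sum_{i=1}^N|x_i|^q$. For a step size $\mu>0$ set $\tau_{\mu,q}=\frac{2-q}{2-2q}(2\lambda\mu(1-q))^{\frac{1}{2-q}}$ and $\eta_{\mu,q}=(2\lambda\mu(1-q))^{\frac{1}{2-q}}$. For $z\in\mathbf{R}$ let $prox_{\mu,\lambda|\cdot|^q}(z)=\arg\min_{v\in\mathbf{R}}\{\frac{(z-v)^2}{2\mu}+\lambda|v|^q\}$ (a single point when $|z|\neq\tau_{\mu,q}$). Define $\mathcal{T}(z,w)$ as the unique element of $prox_{\mu,\lambda|\cdot|^q}(z)$ if $|z|\neq\tau_{\mu,q}$, and, if $|z|=\tau_{\mu,q}$, as $sgn(z)\eta_{\mu,q}$ when $w\neq0$ and $0$ when $w=0$. GAITA: given $x^0\in\mathbf{R}^N$, for $n=0,1,2,\dots$ let $i=(n\bmod N)+1$, $z_i^n=x_i^n-\mu A_i^T(Ax^n-y)$, $x_i^{n+1}=\mathcal{T}(z_i^n,x_i^n)$, $x_j^{n+1}=x_j^n$ for $j\neq i$. $Supp(x)=\{i:x_i\neq0\}$. $A_I$ is the submatrix of $A$ with columns indexed by $I$, and $\lambda_{\min}(M)$ denotes the smallest eigenvalue of a symmetric matrix $M$. *)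

(* Defs.v *)
From HB Require Import structures.
From mathcomp Require Import all_boot all_order all_algebra.
From mathcomp Require Import all_classical all_reals all_analysis.
Set Implicit Arguments. Unset Strict Implicit. Unset Printing Implicit Defensive.
Import Order.TTheory GRing.Theory Num.Theory.
Import numFieldNormedType.Exports.
Local Open Scope classical_set_scope.
Local Open Scope ring_scope.

Section GAITA.
Variables (R : realType) (m N : nat).

Definition sqnorm (k : nat) (v : 'cV[R]_k) : R := \sum_(i < k) (v i 0) ^+ 2.

Definition colsqnorm (A : 'M[R]_(m, N)) (i : 'I_N) : R := sqnorm (col i A).

Definition Lmax (A : 'M[R]_(m, N)) : R := \big[Num.max/0]_(i < N) colsqnorm A i.

Definition Tobj (A : 'M[R]_(m, N)) (y : 'cV[R]_m) (lam q : R) (x : 'cV[R]_N) : R :=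
  sqnorm (A *m x - y) / 2 + lam * \sum_(i < N) powR `|x i 0| q.

Definition Supp (x : 'cV[R]_N) : {set 'I_N} := [set i | x i 0 != 0].

Definition subcols (A : 'M[R]_(m, N)) (I : {set 'I_N}) : 'M[R]_(m, #|I|) :=
  colsub (fun k : 'I_#|I| => enum_val k) A.

Definition lambda_min (k : nat) (M : 'M[R]_k) : R := inf [set a | eigenvalue M a].

(* e = min_{i in Supp x} |x_i| ; the default value (max_i |x_i|) is attained
   on Supp x whenever Supp x is nonempty, so it does not affect the minimum *)
Definition min_abs_supp (x : 'cV[R]_N) : R :=
  \big[Num.min/ \big[Num.max/0]_(i < N) `|x i 0|]_(i < N | x i 0 != 0) `|x i 0|.

Definition is_prox (mu lam q z v : R) : Prop :=
  forall u : R, (z - v) ^+ 2 / (2 * mu) + lam * powR `|v| q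
                <= (z - u) ^+ 2 / (2 * mu) + lam * powR `|u| q.

Definition tau (mu lam q : R) : R :=
  (2 - q) / (2 - 2 * q) * powR (2 * lam * mu * (1 - q)) (1 / (2 - q)).
Definition eta (mu lam q : R) : R :=
  powR (2 * lam * mu * (1 - q)) (1 / (2 - q)).

(* v = T(z, w) : the thresholding map of GAITA (relational form; when |z| <> tau
   the prox is a singleton, so v is its unique element) *)
Definition Tmap (mu lam q z w v : R) : Prop :=
  if `|z| != tau mu lam q then is_prox mu lam q z v
  else v = (if w != 0 then Num.sg z * eta mu lam q else 0).

Definition is_GAITA (A : 'M[R]_(m, N)) (y : 'cV[R]_m) (mu lam q : R)
    (x : nat -> 'cV[R]_N) : Prop :=
  forall n : nat, forall j : 'I_N,
    if (j : nat) == (n %% N)%N then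
      Tmap mu lam q (x n j 0 - mu * ((col j A)^T *m (A *m x n - y)) 0 0)
           (x n j 0) (x n.+1 j 0)
    else x n.+1 j 0 = x n j 0.

Definition strict_local_min (f : 'cV[R]_N -> R) (xs : 'cV[R]_N) : Prop :=
  exists2 d : R, 0 < d &
    forall x : 'cV[R]_N, x != xs -> Num.sqrt (sqnorm (x - xs)) < d -> f xs < f x.

End GAITA.

(* Main.v *)
(** Every value [v] produced by the thresholding map from [z] satisfies
    [v (v - z) + mu lam q |v|^q = 0] (stationarity of the prox objective along
    the ray through [v]) and [2 mu lam (1 - q) |v|^q <= v^2] (comparison with
    [0]). Along the subsequence of steps updating coordinate [j], both pass to
    the limit, so [xs] is stationary on its support [I] and has large enough
    entries there: condition (b) then gives
    [lam q (1 - q) |xs_j|^q < lmin xs_j^2]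
    for [j] in [I], which is also what (a) says.
    Expanding the objective at [xs + h], the coordinates in [I] are controlled
    by the strict convexity [lmin > lam q (1 - q) |xs_j|^(q-2)], while outside
    [I] the term [lam |h_j|^q] dominates everything linear in [h_j], in
    particular the cross terms between [h_I] and the rest of [h]. *)
Require Import Defs.
From HB Require Import structures.
From mathcomp Require Import all_boot all_order all_algebra.
From mathcomp Require Import all_classical all_reals all_analysis.
From mathcomp Require Import ring lra.
Set Implicit Arguments. Unset Strict Implicit. Unset Printing Implicit Defensive.
Import Order.TTheory GRing.Theory Num.Theory.
Import numFieldNormedType.Exports.
Local Open Scope classical_set_scope.
Local Open Scope ring_scope.

(** * Calculus near 0: finite sums of limits, mean values, expansion of [(1 + t)^q] *)

Lemma cvg_fin_sum (R : realType) (I : finType) (T : Type) (F : set_system T)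
    {FF : Filter F} (f : I -> T -> R) (a : I -> R) :
  (forall i, f i t @[t --> F] --> a i) ->
  \sum_i f i t @[t --> F] --> \sum_i a i.
Proof. by move=> fa; apply: cvg_big => //; exact: add_continuous. Qed.

(** The conclusion [0 < c * t] puts [c] strictly on the side of [t]; in particular [c] is nonzero,
    so the lemma can be applied again at [c]. *)
Lemma MVT_ball0 (R : realType) (f df : R -> R) (d t : R) :
  (forall x : R, `|x| < d -> is_derive x 1 f (df x)) ->
  `|t| < d -> t != 0 ->
  exists c, [/\ `|c| < d, 0 < c * t & f t - f 0 = df c * t].
Proof.
move=> fdf td t0.
have cf (a b : R) : `|a| < d -> `|b| < d -> {within `[a, b], continuous f}.
  rewrite !ltr_norml => /andP[? ?] /andP[? ?].
  apply: derivable_within_continuous => x; rewrite in_itv /= => /andP[? ?].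
  have xd : `|x| < d by rewrite ltr_norml; apply/andP; split; lra.
  by have [] := fdf x xd.
have d0 : `|0 : R| < d by rewrite normr0 (le_lt_trans _ td).
have := td; rewrite ltr_norml => /andP[? ?].
case: (ltgtP t 0) t0 => // [tn|tp] _.
- have [x|c] := @MVT R f df t 0 tn _ (cf _ _ td d0).
    rewrite in_itv /= => /andP[? ?]; apply: fdf.
    by rewrite ltr_norml; apply/andP; split; lra.
  rewrite in_itv /= => /andP[? ?] E; exists c; split; last by lra.
    by rewrite ltr_norml; apply/andP; split; lra.
  by rewrite nmulr_lgt0.
- have [x|c] := @MVT R f df 0 t tp _ (cf _ _ d0 td).
    rewrite in_itv /= => /andP[? ?]; apply: fdf.
    by rewrite ltr_norml; apply/andP; split; lra.
  rewrite in_itv /= => /andP[? ?] E; exists c; split; last by lra.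
    by rewrite ltr_norml; apply/andP; split; lra.
  by rewrite pmulr_lgt0.
Qed.

Lemma is_derive_powR1D (R : realType) (p t : R) : `|t| < 1 ->
  is_derive t 1 (fun s => powR (1 + s) p) (p * powR (1 + t) (p - 1)).
Proof.
rewrite ltr_norml => /andP[tm _].
have t1 : 0 < 1 + t by lra.
have dp := is_derive1_powR p t1.
have ds : is_derive t 1 (fun s : R => 1 + s) 1.
  by rewrite -[X in is_derive _ _ _ X]add0r; exact: is_deriveD.
have := @is_derive1_comp R (fun s => powR s p) (fun s => 1 + s) t _ _ dp ds.
by rewrite mulr1.
Qed.

(** The function [f t = (1 + t)^q - q t + c t^2] has [f 0 = 1], [f1 0 = 0] and
    [f2 0 = q (q - 1) + 2 c > 0]. Two mean value steps give [f t - 1 = f2 c2 * (c1 * t)], a product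
    of positive factors. *)
Lemma powR1D_gt_quadratic (R : realType) (q c : R) : q * (1 - q) < 2 * c ->
  \forall t \near (0 : R), t != 0 -> 1 + q * t - c * t ^+ 2 < powR (1 + t) q.
Proof.
move=> qc.
pose f (t : R) := powR (1 + t) q - q * t + c * t ^+ 2.
pose f1 (t : R) := q * powR (1 + t) (q - 1) - q + 2 * c * t.
pose f2 (t : R) := q * ((q - 1) * powR (1 + t) (q - 1 - 1)) + 2 * c.
have Df (t : R) : `|t| < 1 -> is_derive t 1 f (f1 t).
  move=> t1; have dp := is_derive_powR1D q t1.
  rewrite /f; apply: is_derive_eq; rewrite /f1 /GRing.scale /=; ring.
have Df1 (t : R) : `|t| < 1 -> is_derive t 1 f1 (f2 t).
  move=> t1; have dp := is_derive_powR1D (q - 1) t1.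
  rewrite /f1; apply: is_derive_eq; rewrite /f2 /GRing.scale /=; ring.
have f2p : \forall t \near (0 : R), 0 < f2 t.
  have cf2 : {for 0, continuous f2}.
    have d0 : derivable (fun s : R => powR (1 + s) (q - 1 - 1)) 0 1.
      by have := @is_derive_powR1D R (q - 1 - 1) 0; rewrite normr0 => /(_ ltr01)[].
    apply: continuousD; last exact: cvg_cst.
    apply: continuousM; first exact: cvg_cst.
    apply: continuousM; first exact: cvg_cst.
    exact/differentiable_continuous/derivable1_diffP.
  have f20 : 0 < f2 0 by rewrite /f2 addr0 powR1; lra.
  exact: (cvgr_gt (f2 0) cf2).
have /nbhs_ballP[d /= d0 fd] := f2p.
near=> t => t0.
(* The radius [d] keeps [f2] positive; the bound 1 keeps [1 + t] positive, where the power is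
   differentiable. *)
have td : `|t| < Num.min d 1.
  by near: t; apply: (@nbhs0_lt R R^o); rewrite lt_min d0 ltr01.
have Df' (s : R) : `|s| < Num.min d 1 -> is_derive s 1 f (f1 s).
  by rewrite lt_min => /andP[_]; exact: Df.
have Df1' (s : R) : `|s| < Num.min d 1 -> is_derive s 1 f1 (f2 s).
  by rewrite lt_min => /andP[_]; exact: Df1.
have [c1 [c1d c1t ft]] := @MVT_ball0 R f f1 _ t Df' td t0.
have c10 : c1 != 0 by apply: contraTneq c1t => ->; rewrite mul0r ltxx.
have [c2 [c2d c2c1 f1c]] := @MVT_ball0 R f1 f2 _ c1 Df1' c1d c10.
have f20 : 0 < f2 c2.
  apply: fd; rewrite -ball_normE /= sub0r normrN.
  by move: c2d; rewrite lt_min => /andP[].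
have f10 : f1 0 = 0 by rewrite /f1 addr0 powR1; ring.
move: f1c; rewrite f10 subr0 => f1c.
have f0 : f 0 = 1 by rewrite /f addr0 powR1; ring.
move: ft; rewrite f0 f1c -mulrA => ft.
have : 0 < f t - 1 by rewrite ft mulr_gt0.
rewrite /f; lra.
Unshelve. all: by end_near. Qed.

(** * Equation and lower bound for the values of the thresholding map *)

(** Scaling [v] to [v (1 + t)] turns the penalty into [|v|^q (1 + t)^q], smooth at [t = 0] whatever
    the sign of [v]. The derivative vanishes at this minimum; multiplying it by [mu] gives the
    equation. *)
Lemma is_prox_stationary (R : realType) (mu lam q z v : R) :
  0 < mu -> 0 < q -> is_prox mu lam q z v ->
  v * (v - z) + mu * lam * q * powR `|v| q = 0.
Proof.
move=> mu0 q0 pv; have [->|v0] := eqVneq v 0.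
  by rewrite normr0 powR0 ?gt_eqF// !(mul0r, mulr0) addr0.
pose f (t : R) := (z - v * (1 + t)) ^+ 2 / (2 * mu)
                  + lam * powR `|v| q * powR (1 + t) q.
have Df (t : R) : `|t| < 1 -> is_derive t 1 f
    (- (v / mu) * (z - v * (1 + t)) + lam * powR `|v| q * (q * powR (1 + t) (q - 1))).
  move=> t1; have dp := is_derive_powR1D q t1.
  rewrite /f; apply: is_derive_eq; rewrite /GRing.scale /=.
  by field; rewrite gt_eqF.
have in1 (t : R) : t \in `](-1), 1[%R -> `|t| < 1.
  by rewrite in_itv /= ltr_norml.
have D0 : is_derive (0 : R) 1 f 0.
  apply: (@derive1_at_min R f (-1) 1 0); first by lra.
  - by move=> t /in1 /Df [].
  - by rewrite in_itv /= ltr01 andbT oppr_lt0 ltr01.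
  - move=> t /in1; rewrite ltr_norml => /andP[t1 _].
    have t1' : 0 <= 1 + t by lra.
    have := pv (v * (1 + t)).
    by rewrite /f normrM (ger0_norm t1') powRM// addr0 powR1 !mulr1 mulrA.
have n0 : `|0 : R| < 1 by rewrite normr0.
have := @derive_val _ _ _ _ _ _ _ (Df _ n0).
rewrite (@derive_val _ _ _ _ _ _ _ D0) addr0 powR1 !mulr1 => E.
rewrite -[RHS](mulr0 mu) E; field; by rewrite gt_eqF.
Qed.

(** Comparison with [u = 0] bounds [v^2 - 2 z v + 2 mu lam |v|^q] by 0, and stationarity eliminates
    [z v]. *)
Lemma is_prox_lower (R : realType) (mu lam q z v : R) :
  0 < mu -> 0 < q -> is_prox mu lam q z v ->
  2 * mu * lam * (1 - q) * powR `|v| q <= v ^+ 2.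
Proof.
move=> mu0 q0 pv; have := is_prox_stationary mu0 q0 pv.
have := pv 0; rewrite normr0 powR0 ?gt_eqF// mulr0 addr0 subr0.
rewrite -(ler_pM2r (_ : 0 < 2 * mu)); last by rewrite mulr_gt0.
rewrite mulrDl !divfK ?gt_eqF ?mulr_gt0// => H1 H2; lra.
Qed.

(* Multiplying the stationarity equation by [v] makes it valid at [v = 0] as
   well, so that it survives passing to the limit without a case split. *)
Lemma Tmap_stationary (R : realType) (mu lam q z w v : R) :
  0 < mu -> 0 < lam -> 0 < q -> q < 1 -> Tmap mu lam q z w v ->
  v * (v - z) + mu * lam * q * powR `|v| q = 0 /\
  2 * mu * lam * (1 - q) * powR `|v| q <= v ^+ 2.
Proof.
move=> mu0 lam0 q0 q1; rewrite /Tmap; case: ifPn => [_ pv|/negPn/eqP ztau].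
  by split; [apply: is_prox_stationary pv|apply: is_prox_lower pv].
have z00 : powR 0 q = 0 :> R by rewrite powR0 ?gt_eqF.
case: ifP => _ ->; last by rewrite normr0 z00; split; rewrite ?mulr0 ?expr0n /=; lra.
set b := 2 * lam * mu * (1 - q).
have b0 : 0 < b by rewrite /b !mulr_gt0// subr_gt0.
have e0 : 0 < Defs.eta mu lam q by apply: powR_gt0.
(* As [1 + q / (2 - q) = 2 / (2 - q)], the lower bound is an equality at [eta]. *)
have eb : b * powR (Defs.eta mu lam q) q = Defs.eta mu lam q ^+ 2.
  rewrite -powR_mulrn ?ltW// /Defs.eta -!powRrM -/b -{1}(powRr1 (ltW b0)) -powRD; last first.
    by apply/implyP => _; rewrite gt_eqF.
  by congr powR; field; rewrite gt_eqF// subr_gt0; lra.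
have ztau' : `|z| = (2 - q) / (2 - 2 * q) * Defs.eta mu lam q by exact: ztau.
have z0 : z != 0.
  rewrite -normr_gt0 ztau' mulr_gt0// divr_gt0; lra.
have sz : `|Num.sg z * Defs.eta mu lam q| = Defs.eta mu lam q.
  by rewrite normrM normr_sg z0 mul1r gtr0_norm.
have s2 : Num.sg z ^+ 2 = 1 by rewrite sqr_sg z0.
have zE : z = Num.sg z * `|z| by rewrite -numEsg.
split; rewrite sz.
- rewrite {3}zE ztau'.
  have -> : mu * lam * q * powR (Defs.eta mu lam q) q = q / (2 * (1 - q)) * Defs.eta mu lam q ^+ 2.
    by rewrite -eb /b; field; rewrite gt_eqF// subr_gt0.
  set e := Defs.eta _ _ _; set s := Num.sg z in s2 *.
  (* Here [1 - (2 - q) / (2 - 2 q) = - q / (2 (1 - q))], which cancels the penalty term just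
     rewritten. *)
  have -> : s * e * (s * e - s * ((2 - q) / (2 - 2 * q) * e)) =
            s ^+ 2 * (e ^+ 2 * (1 - (2 - q) / (2 - 2 * q))) by ring.
  by rewrite s2; field; apply/andP; split; rewrite gt_eqF//; lra.
- by rewrite exprMn s2 mul1r -eb /b le_eqVlt; apply/orP; left; apply/eqP; ring.
Qed.

(** * Quadratic forms and the smallest eigenvalue *)

Lemma form_rV (R : realType) (n : nat) (M : 'M[R]_n) (u : 'rV[R]_n) :
  (u *m M *m u^T) 0 0 = \sum_j (\sum_i u 0 i * M i j) * u 0 j.
Proof. by rewrite mxE; apply: eq_bigr => j _; rewrite !mxE. Qed.

Lemma continuous_form (R : realType) (n : nat) (M : 'M[R]_n) :
  continuous (fun u : 'rV[R]_n => (u *m M *m u^T) 0 0).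
Proof.
rewrite (_ : (fun _ => _) = fun u : 'rV[R]_n => \sum_j (\sum_i u 0 i * M i j) * u 0 j);
  last by apply/funext => u; exact: form_rV.
move=> u; apply: (@cvg_fin_sum _ _ _ (nbhs u)) => j; apply: cvgM; last exact: coord_continuous.
apply: (@cvg_fin_sum _ _ _ (nbhs u)) => i.
by apply: cvgM; [exact: coord_continuous|exact: cvg_cst].
Qed.

Lemma dotrr (R : realType) (n : nat) (u : 'rV[R]_n) :
  (u *m u^T) 0 0 = \sum_j u 0 j ^+ 2.
Proof. by rewrite mxE; apply: eq_bigr => j _; rewrite mxE expr2. Qed.

Lemma dotrr_ge0 (R : realType) (n : nat) (u : 'rV[R]_n) : 0 <= (u *m u^T) 0 0.
Proof. by rewrite dotrr sumr_ge0// => j _; rewrite sqr_ge0. Qed.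

Lemma dotrr_eq0 (R : realType) (n : nat) (u : 'rV[R]_n) :
  ((u *m u^T) 0 0 == 0) = (u == 0).
Proof.
apply/eqP/eqP => [|->]; last by rewrite mul0mx mxE.
rewrite dotrr => /psumr_eq0P u0; apply/rowP => j; rewrite mxE.
by apply/eqP; rewrite -sqrf_eq0; apply/eqP/u0 => // i _; rewrite sqr_ge0.
Qed.

(** The continuous form attains its minimum on the compact unit sphere; homogeneity of degree 2
    extends the bound to every [u]. *)
Lemma form_min_sphere (R : realType) (n : nat) (M : 'M[R]_n.+1) :
  exists2 v : 'rV[R]_n.+1, (v *m v^T) 0 0 = 1 &
    forall u : 'rV[R]_n.+1,
      (v *m M *m v^T) 0 0 * (u *m u^T) 0 0 <= (u *m M *m u^T) 0 0.
Proof.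
pose S := [set u : 'rV[R]_n.+1 | (u *m u^T) 0 0 = 1].
have S0 : S !=set0.
  exists (delta_mx 0 0); rewrite /S /= trmx_delta mul_delta_mx.
  by rewrite mxE !eqxx.
have cS : compact S.
  apply: bounded_closed_compact.
    exists 1; split => // M' M'1 u /= uS.
    apply: le_trans (ltW M'1).
    rewrite [leLHS]/Num.norm /= mx_normrE; apply: bigmax_le => // -[i j] _ /=.
    rewrite (ord1 i) -(ler_pXn2r (n := 2)) ?nnegrE//.
    rewrite real_normK ?num_real// expr1n -uS dotrr (bigD1 j)//= lerDl.
    by rewrite sumr_ge0// => k _; rewrite sqr_ge0.
  (* Inserting the identity matrix makes the squared norm an instance of [continuous_form]. *)
  have -> : S = (fun u : 'rV[R]_n.+1 => (u *m 1%:M *m u^T) 0 0) @^-1` [set 1].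
    by apply/seteqP; split => u /=; rewrite mulmx1.
  apply: closed_comp => [u _|]; first exact: continuous_form.
  exact: closed_eq.
have := @EVT_min_rV R n.+1 (fun u => (u *m M *m u^T) 0 0) S S0 cS.
have cf := @continuous_subspaceT _ _ S _ (@continuous_form R n.+1 M).
case/(_ cf) => v vS vmin.
have v1 : (v *m v^T) 0 0 = 1 by move: vS; rewrite inE.
exists v => // u.
have [->|u0] := eqVneq u 0; first by rewrite !mul0mx !mxE mulr0.
have nu : 0 < (u *m u^T) 0 0 by rewrite lt_def dotrr_eq0 u0 dotrr_ge0.
have sc (k : R) (P : 'M[R]_n.+1) :
    (k *: u *m P *m (k *: u)^T) 0 0 = k ^+ 2 * (u *m P *m u^T) 0 0.
  by rewrite linearZ /= -!scalemxAl -scalemxAr scalerA mxE expr2.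
pose k := (Num.sqrt ((u *m u^T) 0 0))^-1.
have k2 : k ^+ 2 = ((u *m u^T) 0 0)^-1 by rewrite exprVn sqr_sqrtr// ltW.
have := vmin (k *: u); rewrite inE sc /S /= => H.
rewrite -ler_pdivlMr// mulrC -k2; apply: H.
by have := sc k 1%:M; rewrite !mulmx1 => ->; rewrite k2 mulVf// gt_eqF.
Qed.

(** Moving from [v] along [r = v M] changes the form to [2 t b + t^2 p] with [b = |r|^2]; a small
    negative [t] would make it negative unless [b = 0]. *)
Lemma psd_form_eq0 (R : realType) (n : nat) (M : 'M[R]_n) (v : 'rV[R]_n) :
  M^T = M -> (forall u : 'rV[R]_n, 0 <= (u *m M *m u^T) 0 0) ->
  (v *m M *m v^T) 0 0 = 0 -> v *m M = 0.
Proof.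
move=> Ms psd v0; set r := v *m M; pose p := (r *m M *m r^T) 0 0.
pose b := (r *m r^T) 0 0.
have E (t : R) : ((v + t *: r) *m M *m (v + t *: r)^T) 0 0 = 2 * t * b + t ^+ 2 * p.
  have rv : (r *m M *m v^T) 0 0 = b.
    have -> : (r *m M *m v^T) 0 0 = (r *m M *m v^T)^T 0 0 by rewrite [RHS]mxE.
    by rewrite trmx_mul trmxK trmx_mul Ms mulmxA -/r.
  rewrite [(_ + _)^T]linearD /= [(_ *: _)^T]linearZ /= !mulmxDl !mulmxDr.
  rewrite -!scalemxAl -!scalemxAr.
  have D (P Q : 'M[R]_1) : (P + Q) 0 0 = P 0 0 + Q 0 0 by rewrite mxE.
  have Z a (P : 'M[R]_1) : (a *: P) 0 0 = a * P 0 0 by rewrite mxE.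
  rewrite !(D, Z) v0 rv -/r -/b -/p; ring.
have p0 : 0 <= p by exact: psd.
(* The denominator is [p + 1] because [p] may vanish. *)
have := psd (v + - (b / (p + 1)) *: r); rewrite E => H.
apply/eqP; rewrite -dotrr_eq0 -/b.
have p1 : 0 < p + 1 by lra.
have Eb : 2 * - (b / (p + 1)) * b + (- (b / (p + 1))) ^+ 2 * p
  = - ((b / (p + 1)) ^+ 2 * (p + 2)) by field; rewrite gt_eqF.
move: H; rewrite Eb oppr_ge0 pmulr_lle0; last by lra.
move=> H; have : (b / (p + 1)) ^+ 2 == 0 by rewrite eq_le H sqr_ge0.
by rewrite sqrf_eq0 mulf_eq0 invr_eq0 (gt_eqF p1) orbF.
Qed.

(** By [psd_form_eq0] applied to [M - a], the minimizer [v] on the sphere is an eigenvector for the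
    minimum [a], so the infimum of the eigenvalues is at most [a]. *)
Lemma lambda_min_form (R : realType) (n : nat) (M : 'M[R]_n) (u : 'rV[R]_n) :
  M^T = M -> lambda_min M * (u *m u^T) 0 0 <= (u *m M *m u^T) 0 0.
Proof.
case: n M u => [|n] M u Ms.
  by rewrite [u]thinmx0 !mul0mx mxE mulr0.
have [v v1 vmin] := form_min_sphere M.
set a := (v *m M *m v^T) 0 0 in vmin.
have v0 : v != 0 by rewrite -dotrr_eq0 v1 oner_eq0.
have Ea (w : 'rV[R]_n.+1) : (w *m (M - a%:M) *m w^T) 0 0
    = (w *m M *m w^T) 0 0 - a * (w *m w^T) 0 0.
  by rewrite mulmxBr mulmxBl mul_mx_scalar -scalemxAl !mxE.
have ev : v *m M = a *: v.
  apply/eqP; rewrite -subr_eq0 -mul_mx_scalar -mulmxBr; apply/eqP.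
  apply: psd_form_eq0.
  - by rewrite linearB /= tr_scalar_mx Ms.
  - by move=> w; rewrite Ea subr_ge0.
  - by rewrite Ea v1 mulr1 subrr.
apply: le_trans (vmin u); rewrite ler_wpM2r ?dotrr_ge0//.
apply: ge_inf; last by apply/eigenvalueP; exists v.
(* The infimum needs a lower bound of the spectrum: [a] is one. *)
exists a => b /eigenvalueP[w wM w0].
have nw : 0 < (w *m w^T) 0 0 by rewrite lt_def dotrr_eq0 w0 dotrr_ge0.
have := vmin w; rewrite wM -scalemxAl [X in _ <= X]mxE.
by rewrite ler_pM2r.
Qed.

Lemma lambda_min_gram (R : realType) (m n : nat) (B : 'M[R]_(m, n)) (u : 'cV[R]_n) :
  lambda_min (B^T *m B) * sqnorm u <= sqnorm (B *m u).
Proof.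
have sq k (w : 'cV[R]_k) : sqnorm w = (w^T *m w) 0 0.
  by rewrite mxE; apply: eq_bigr => i _; rewrite mxE expr2.
have := @lambda_min_form R n (B^T *m B) u^T.
by rewrite !sq trmxK !trmx_mul trmxK !mulmxA => ->.
Qed.

(** * Local growth of [lam |.|^q] at nonzero points and at 0 *)

(** With [h = a t] one has [|a + h|^q = |a|^q (1 + t)^q], so this is [powR1D_gt_quadratic]
    multiplied by [lam |a|^q]. The subtracted linear term is the derivative at [a]. *)
Lemma powR_second_order_growth (R : realType) (lam q l a : R) :
  0 < lam -> a != 0 -> lam * q * (1 - q) * powR `|a| q < l * a ^+ 2 ->
  \forall h \near (0 : R), h != 0 ->
    0 < l / 2 * h ^+ 2 + lam * (powR `|a + h| q - powR `|a| q)
        - lam * q * powR `|a| q / a * h.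
Proof.
move=> lam0 a0 la; have na : 0 < `|a| by rewrite normr_gt0.
set p := powR `|a| q; have p0 : 0 < p by exact: powR_gt0.
(* Chosen so that [lam p c t^2 = l / 2 * h^2]; the hypothesis then reads [q (1 - q) < 2 c]. *)
pose c := l * a ^+ 2 / (2 * lam * p).
have qc : q * (1 - q) < 2 * c.
  rewrite /c mulrA ltr_pdivlMr ?mulr_gt0//; rewrite -/p in la; lra.
have /nbhs_ballP[d /= d0 hd] := powR1D_gt_quadratic qc.
apply: filterS (@nbhs0_lt R R^o (`|a| * Num.min d 1) _); last first.
  by rewrite mulr_gt0// lt_min d0 ltr01.
move=> h /= hsmall h0; set t := h / a.
have tsmall : `|t| < Num.min d 1 by rewrite normf_div ltr_pdivrMr// mulrC.
move: (tsmall); rewrite lt_min => /andP[td]; rewrite ltr_norml => /andP[t1 _].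
have t0 : t != 0 by rewrite mulf_neq0// invr_eq0.
have H : 1 + q * t - c * t ^+ 2 < powR (1 + t) q.
  by apply: hd => //; rewrite -ball_normE /= sub0r normrN.
have ah : powR `|a + h| q = p * powR (1 + t) q.
  have t1' : 0 <= 1 + t by lra.
  have -> : a + h = a * (1 + t) by rewrite /t; field.
  by rewrite normrM powRM// (ger0_norm t1').
have lp : 0 < lam * p by rewrite mulr_gt0.
rewrite ah; have := H; rewrite -(ltr_pM2l lp) => H'.
have Ec : lam * p * (c * t ^+ 2) = l / 2 * h ^+ 2.
  by rewrite /c /t; field; rewrite a0 !gt_eqF.
have Eq : lam * p * (q * t) = lam * q * p / a * h by rewrite /t; field.
rewrite mulrBr mulrDr Ec Eq in H'; lra.
Qed.

(** Write [|h| = |h|^(1 - q) |h|^q]; the first factor tends to 0 with [h]. *)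
Lemma powR_dominates_linear (R : realType) (lam q C : R) :
  0 < lam -> 0 < q -> q < 1 ->
  \forall h \near (0 : R), h != 0 -> C * `|h| < lam * powR `|h| q.
Proof.
move=> lam0 q0 q1; have q1' : 0 < 1 - q by rewrite subr_gt0.
have C1 : 0 < `|C| + 1 by rewrite ltr_wpDl.
set b := lam / (`|C| + 1); have b0 : 0 < b by rewrite divr_gt0.
apply: filterS (@nbhs0_lt R R^o (powR b (1 / (1 - q))) _); last exact: powR_gt0.
move=> h /= hb h0; have nh : 0 < `|h| by rewrite normr_gt0.
have hq : powR `|h| (1 - q) < b.
  have -> : b = powR (powR b (1 / (1 - q))) (1 - q).
    by rewrite -powRrM divfK ?gt_eqF// powRr1// ltW.
  by apply: gt0_ltr_powR => //; rewrite nnegrE ?powR_ge0.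
have E : `|h| = powR `|h| (1 - q) * powR `|h| q.
  rewrite -powRD; last by apply/implyP => _; rewrite gt_eqF.
  by rewrite subrK powRr1// ltW.
have hq0 : 0 < powR `|h| q by exact: powR_gt0.
rewrite {1}E mulrA ltr_pM2r//.
apply: (@le_lt_trans _ _ ((`|C| + 1) * powR `|h| (1 - q))).
  by rewrite ler_wpM2r ?powR_ge0//; have := ler_norm C; lra.
by rewrite mulrC -ltr_pdivlMr.
Qed.

(** * Passage to the limit along the iteration *)

(** This is the [j]-th partial derivative of the quadratic part of the objective. *)
Definition residual_corr (R : realType) (m N : nat) (A : 'M[R]_(m, N))
    (y : 'cV[R]_m) (w : 'cV[R]_N) (j : 'I_N) : R :=
  ((col j A)^T *m (A *m w - y)) 0 0.

Lemma continuous_residual_corr (R : realType) (m N : nat) (A : 'M[R]_(m, N))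
    (y : 'cV[R]_m) (j : 'I_N) : continuous (residual_corr A y ^~ j).
Proof.
have E w : residual_corr A y w j = \sum_k A k j * (\sum_i A k i * w i 0 - y k 0).
  by rewrite /residual_corr mxE; apply: eq_bigr => k _; rewrite !mxE.
rewrite (_ : residual_corr A y ^~ j =
    fun w => \sum_k A k j * (\sum_i A k i * w i 0 - y k 0));
  last by apply/funext => w; exact: E.
move=> w; apply: (@cvg_fin_sum _ _ _ (nbhs w)) => k.
apply: cvgM; first exact: cvg_cst.
apply: cvgB; last exact: cvg_cst.
apply: (@cvg_fin_sum _ _ _ (nbhs w)) => i.
by apply: cvgM; [exact: cvg_cst|exact: coord_continuous].
Qed.

Lemma GAITA_limit_stationary (R : realType) (m N : nat) (A : 'M[R]_(m, N))
    (y : 'cV[R]_m) (lam q mu : R) (x : nat -> 'cV[R]_N) (xs : 'cV[R]_N) :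
  0 < lam -> 0 < q -> q < 1 -> 0 < mu -> is_GAITA A y mu lam q x ->
  x @ \oo --> xs -> forall j,
  xs j 0 * residual_corr A y xs j + lam * q * powR `|xs j 0| q = 0 /\
  2 * mu * lam * (1 - q) * powR `|xs j 0| q <= xs j 0 ^+ 2.
Proof.
move=> lam0 q0 q1 mu0 GA xxs j; pose grad := residual_corr A y.
rewrite -/grad.
(* Both claims are trivial at 0; elsewhere [|.|^q] is differentiable, hence continuous. *)
have [->|xj0] := eqVneq (xs j 0) 0.
  by rewrite normr0 powR0 ?gt_eqF// !(mul0r, mulr0) addr0 expr0n.
have N0 : (0 < N)%N by apply: leq_trans (ltn_ord j).
(* The steps updating coordinate [j]: [z] is read at [n k], the new value at [(n k).+1]. *)
pose n k := (k * N + j)%N.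
have nE k : (n k %% N)%N = j by rewrite modnMDl modn_small.
have noo : n @ \oo --> \oo.
  apply/cvgnyPge => M; exists M => // k /= Mk.
  by rewrite /n (leq_trans Mk)// (leq_trans (leq_pmulr _ N0))// leq_addr.
have nSoo : (fun k => (n k).+1) @ \oo --> \oo.
  apply/cvgnyPge => M; exists M => // k /= Mk.
  by rewrite leqW// /n (leq_trans Mk)// (leq_trans (leq_pmulr _ N0))// leq_addr.
have xn : x (n k) @[k --> \oo] --> xs by exact: cvg_comp noo xxs.
have xS : x (n k).+1 @[k --> \oo] --> xs by exact: cvg_comp nSoo xxs.
pose v k := x (n k).+1 j 0.
pose z k := x (n k) j 0 - mu * grad (x (n k)) j.
have vl : v k @[k --> \oo] --> xs j 0.
  exact: (cvg_comp _ _ xS (@coord_continuous R N 1 j 0 xs)).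
have zl : z k @[k --> \oo] --> xs j 0 - mu * grad xs j.
  apply: cvgB; first exact: (cvg_comp _ _ xn (@coord_continuous R N 1 j 0 xs)).
  apply: cvgM; first exact: cvg_cst.
  exact: (cvg_comp _ _ xn (@continuous_residual_corr R m N A y j xs)).
have pl : powR `|v k| q @[k --> \oo] --> powR `|xs j 0| q.
  have nx : 0 < `|xs j 0| by rewrite normr_gt0.
  have cp : {for `|xs j 0|, continuous (fun s : R => powR s q)}.
    have [dp _] := is_derive1_powR q nx.
    exact/differentiable_continuous/derivable1_diffP.
  exact: (cvg_comp _ _ (cvg_norm vl) cp).
have T k : v k * (v k - z k) + mu * lam * q * powR `|v k| q = 0 /\
           2 * mu * lam * (1 - q) * powR `|v k| q <= v k ^+ 2.
  have := GA (n k) j; rewrite nE eqxx; exact: Tmap_stationary.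
split.
- have L : v k * (v k - z k) + mu * lam * q * powR `|v k| q @[k --> \oo] -->
      xs j 0 * (xs j 0 - (xs j 0 - mu * grad xs j)) + mu * lam * q * powR `|xs j 0| q.
    apply: cvgD; first by apply: cvgM => //; exact: cvgB.
    by apply: cvgM => //; exact: cvg_cst.
  have L0 : v k * (v k - z k) + mu * lam * q * powR `|v k| q @[k --> \oo] --> (0 : R).
    rewrite (_ : (fun k => _) = fun=> 0); first exact: cvg_cst.
    by apply/funext => k; have [] := T k.
  have E := cvg_lim (@norm_hausdorff R R^o) L0.
  rewrite (cvg_lim (@norm_hausdorff R R^o) L) in E.
  (* In the limit [v - z] becomes [mu] times the partial derivative, so [mu] factors out. *)
  by apply: (mulfI (lt0r_neq0 mu0)); rewrite mulr0 -E; ring.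
- have L : 2 * mu * lam * (1 - q) * powR `|v k| q @[k --> \oo] -->
      2 * mu * lam * (1 - q) * powR `|xs j 0| q.
    by apply: cvgM => //; exact: cvg_cst.
  have L2 : v k ^+ 2 @[k --> \oo] --> xs j 0 ^+ 2.
    by under eq_cvg do rewrite expr2; rewrite expr2; exact: cvgM.
  apply: (ler_cvg_to L L2).
  by near=> k; have [] := T k.
Unshelve. all: by end_near. Qed.

(** * Expansion of the objective and the second-order sufficient condition *)

Lemma sqnormD (R : realType) (n : nat) (u v : 'cV[R]_n) :
  sqnorm (u + v) = sqnorm u + 2 * (u^T *m v) 0 0 + sqnorm v.
Proof.
rewrite /sqnorm mxE mulr_sumr -!big_split /=; apply: eq_bigr => i _.
by rewrite !mxE; ring.
Qed.

Lemma normr_le_sqnorm (R : realType) (n : nat) (u : 'cV[R]_n) (i : 'I_n) :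
  `|u i 0| <= Num.sqrt (sqnorm u).
Proof.
rewrite -sqrtr_sqr ler_wsqrtr// /sqnorm (bigD1 i)//= lerDl.
by rewrite sumr_ge0// => k _; rewrite sqr_ge0.
Qed.

(** Dropping the zero entries of [h] outside [I] changes neither its norm nor [A h], which leaves
    the Gram bound for the submatrix. *)
Lemma lambda_min_subcols (R : realType) (m N : nat) (A : 'M[R]_(m, N))
    (I : {set 'I_N}) (h : 'cV[R]_N) : (forall i, i \notin I -> h i 0 = 0) ->
  lambda_min ((subcols A I)^T *m subcols A I) * sqnorm h <= sqnorm (A *m h).
Proof.
move=> hI; pose hs : 'cV[R]_#|I| := \col_k h (enum_val k) 0.
have supp (F : 'I_N -> R) : (forall i, i \notin I -> F i = 0) ->
    \sum_i F i = \sum_(k < #|I|) F (enum_val k).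
  move=> F0; rewrite (bigID (mem I))/= [X in _ + X]big1 ?addr0; last exact: F0.
  by rewrite big_enum_val.
have -> : sqnorm h = sqnorm hs.
  rewrite /sqnorm supp; last by move=> i /hI ->; rewrite expr0n.
  by apply: eq_bigr => k _; rewrite mxE.
have -> : A *m h = subcols A I *m hs.
  apply/matrixP => r k; rewrite !mxE (ord1 k) supp; last by move=> i /hI ->; rewrite mulr0.
  by apply: eq_bigr => i _; rewrite !mxE.
exact: lambda_min_gram.
Qed.

Lemma TobjB (R : realType) (m N : nat) (A : 'M[R]_(m, N)) (y : 'cV[R]_m)
    (lam q : R) (xs h : 'cV[R]_N) :
  Tobj A y lam q (xs + h) - Tobj A y lam q xs =
  \sum_j (((col j A)^T *m (A *m xs - y)) 0 0 * h j 0
          + lam * (powR `|xs j 0 + h j 0| q - powR `|xs j 0| q))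
  + sqnorm (A *m h) / 2.
Proof.
have -> : \sum_j (((col j A)^T *m (A *m xs - y)) 0 0 * h j 0
          + lam * (powR `|xs j 0 + h j 0| q - powR `|xs j 0| q)) =
    ((A *m xs - y)^T *m (A *m h)) 0 0
    + lam * (\sum_j powR `|(xs + h) j 0| q - \sum_j powR `|xs j 0| q).
  rewrite big_split /= -mulr_sumr; congr (_ + lam * _).
    rewrite mulmxA mxE; apply: eq_bigr => j _; congr (_ * _).
    by rewrite !mxE; apply: eq_bigr => k _; rewrite !mxE mulrC.
  by rewrite sumrB; congr (_ - _); apply: eq_bigr => j _; rewrite mxE.
rewrite /Tobj mulmxDr (addrAC (A *m xs)) sqnormD; lra.
Qed.

(** A crude bound, uniform in [u] and [j], for the coefficients of the cross terms. *)
Lemma gram_coord_le (R : realType) (m N : nat) (A : 'M[R]_(m, N))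
    (u : 'cV[R]_N) (j : 'I_N) : (forall i, `|u i 0| <= 1) ->
  `|(A^T *m A *m u) j 0| <= \sum_i \sum_k `|(A^T *m A) i k|.
Proof.
move=> u1; rewrite mxE; apply: le_trans (ler_norm_sum _ _ _) _.
apply: (@le_trans _ _ (\sum_k `|(A^T *m A) j k|)).
  by apply: ler_sum => k _; rewrite normrM ler_piMr.
rewrite [leRHS](bigD1 j)//= lerDl sumr_ge0// => i _.
by rewrite sumr_ge0.
Qed.

(** The increment of the objective is bounded below by a sum of one-coordinate terms [D j], each
    positive as soon as [h j 0] is nonzero. *)
Lemma stationary_strict_local_min (R : realType) (m N : nat) (A : 'M[R]_(m, N))
    (y : 'cV[R]_m) (lam q : R) (xs : 'cV[R]_N) :
  let lmin := lambda_min ((subcols A (Supp xs))^T *m subcols A (Supp xs)) in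
  0 < lam -> 0 < q -> q < 1 ->
  (forall j, xs j 0 * ((col j A)^T *m (A *m xs - y)) 0 0
             + lam * q * powR `|xs j 0| q = 0) ->
  (forall j, xs j 0 != 0 ->
     lam * q * (1 - q) * powR `|xs j 0| q < lmin * xs j 0 ^+ 2) ->
  strict_local_min (Tobj A y lam q) xs.
Proof.
move=> l lam0 q0 q1 st so.
pose g j := ((col j A)^T *m (A *m xs - y)) 0 0.
pose B := \sum_i \sum_k `|(A^T *m A) i k|.
pose P j (h : R) := h != 0 ->
    if xs j 0 != 0 then
      0 < l / 2 * h ^+ 2 + lam * (powR `|xs j 0 + h| q - powR `|xs j 0| q) + g j * h
    else (`|g j| + B) * `|h| < lam * powR `|h| q.
have nearP : \forall h \near (0 : R), forall j, P j h.
  apply: (@filter_forall _ _ P (nbhs (0 : R)) _) => j.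
  have [xj|xj] := boolP (xs j 0 != 0); last first.
    apply: filterS (powR_dominates_linear (`|g j| + B) lam0 q0 q1) => h H.
    by rewrite /P (negPf xj).
  apply: filterS (powR_second_order_growth lam0 xj (so j xj)) => h hg.
  rewrite /P xj => /hg.
  have -> : g j = - (lam * q * powR `|xs j 0| q / xs j 0).
    apply: (mulfI xj); rewrite mulrN [in RHS]mulrC divfK//.
    by apply/eqP; rewrite -addr_eq0; apply/eqP; exact: st.
  lra.
have /nbhs_ballP[d /= d0 hd] := nearP.
(* Radius [d] gives [P j] at every entry of [h]; radius 1 makes [gram_coord_le] applicable to
   [hI]. *)
exists (Num.min d 1); first by rewrite lt_min d0 ltr01.
move=> x xxs dx; set h := x - xs in dx *.
have -> : x = xs + h by rewrite addrC subrK.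
have h0 : h != 0 by rewrite subr_eq0.
clearbody h => {x xxs}.
have hj j : `|h j 0| < Num.min d 1 by apply: le_lt_trans dx; exact: normr_le_sqnorm.
pose hI : 'cV[R]_N := \col_i if xs i 0 != 0 then h i 0 else 0.
pose hJ : 'cV[R]_N := \col_i if xs i 0 != 0 then 0 else h i 0.
have hIJ : h = hI + hJ.
  by apply/matrixP => i k; rewrite !mxE (ord1 k); case: ifP; rewrite ?addr0 ?add0r.
have hI1 i : `|hI i 0| <= 1.
  rewrite mxE; case: ifP => _; last by rewrite normr0.
  by have := hj i; rewrite lt_min => /andP[_ /ltW].
pose c j := (A^T *m A *m hI) j 0.
(* Expand [|A hI + A hJ|^2]: the eigenvalue bounds the first square, the last square is dropped, and
   the cross term is linear in [hJ]. *)
have Ah : sqnorm (A *m h) >= \sum_j (l * hI j 0 ^+ 2 + 2 * (c j * hJ j 0)).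
  have -> : \sum_j (l * hI j 0 ^+ 2 + 2 * (c j * hJ j 0)) =
      l * sqnorm hI + 2 * ((A *m hI)^T *m (A *m hJ)) 0 0.
    rewrite big_split /= -!mulr_sumr; congr (_ + 2 * _).
    have -> : (A *m hI)^T *m (A *m hJ) = (A^T *m A *m hI)^T *m hJ.
      by rewrite !trmx_mul trmxK !mulmxA.
    by rewrite [RHS]mxE; apply: eq_bigr => j _; rewrite [in RHS]mxE.
  rewrite {1}hIJ mulmxDr sqnormD; apply: (@le_trans _ _
    (sqnorm (A *m hI) + 2 * ((A *m hI)^T *m (A *m hJ)) 0 0)).
    rewrite lerD2r; apply: lambda_min_subcols => i.
    by rewrite inE negbK mxE => /eqP ->; rewrite eqxx.
  by rewrite lerDl sumr_ge0// => i _; rewrite sqr_ge0.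
rewrite -subr_gt0 TobjB.
pose D j := g j * h j 0 + lam * (powR `|xs j 0 + h j 0| q - powR `|xs j 0| q)
            + (l * hI j 0 ^+ 2 + 2 * (c j * hJ j 0)) / 2.
apply: (@lt_le_trans _ _ (\sum_j D j)); last first.
  by rewrite big_split /= lerD2l -mulr_suml ler_wpM2r// invr_ge0.
have Dpos j : h j 0 != 0 -> 0 < D j.
  move=> hj0; have : P j (h j 0).
    apply: hd; rewrite -ball_normE /= sub0r normrN.
    by have := hj j; rewrite lt_min => /andP[].
  move=> /(_ hj0).
  rewrite /D /hI /hJ !mxE; case: ifPn => xj.
    by rewrite mulr0; lra.
  move/negPn/eqP: xj => ->; rewrite add0r normr0 powR0 ?gt_eqF// expr0n /= subr0 => H.
  (* Off the support the linear coefficient is [g j + c j], with [c j] at most [B] in absolute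
     value. *)
  have H1 : - (`|g j| + B) * `|h j 0| <= (g j + c j) * h j 0.
    rewrite mulNr lerNl -mulrN; apply: le_trans (ler_norm _) _.
    rewrite normrM normrN ler_wpM2r//; apply: le_trans (ler_normD _ _) _.
    by rewrite lerD2l; exact: gram_coord_le.
  lra.
have D0 j : 0 <= D j.
  have [hj0|/Dpos/ltW//] := eqVneq (h j 0) 0.
  by rewrite /D !mxE hj0 addr0 subrr if_same expr0n /= !mulr0 !addr0 mul0r.
have [j hj0] : exists j, h j 0 != 0.
  apply/existsP; apply: contraNT h0; rewrite negb_exists => /forallP H.
  apply/eqP/matrixP => i k; rewrite (ord1 k) [RHS]mxE; apply/eqP.
  by have := H i; rewrite negbK.
by rewrite (bigD1 j)//= ltr_pwDl ?Dpos// sumr_ge0.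
Qed.

(** * Either condition implies the second-order inequality on the support *)

Lemma min_abs_supp_le (R : realType) (N : nat) (x : 'cV[R]_N) (j : 'I_N) :
  x j 0 != 0 -> 0 <= min_abs_supp x <= `|x j 0|.
Proof.
move=> xj; apply/andP; split; last exact: bigmin_le_cond.
by apply: le_bigmin => // ; exact: bigmax_ge_id.
Qed.

Unset Implicit Arguments.

Theorem theorem6 (R : realType) (m N : nat) (A : 'M[R]_(m, N)) (y : 'cV[R]_m)
    (lam q mu : R) (x : nat -> 'cV[R]_N) (xs : 'cV[R]_N) :
  (0 < N)%N -> 0 < lam -> 0 < q -> q < 1 ->
  0 < mu -> mu * Lmax A < 1 ->
  is_GAITA A y mu lam q x ->
  x @ \oo --> xs ->
  let I := Supp xs in
  let lmin := lambda_min ((subcols A I)^T *m subcols A I) in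
  let e := min_abs_supp xs in
  (0 < lmin /\ lam < lmin * powR e (2 - q) / (q * (1 - q)))
  \/ (q / 2 * Lmax A < lmin /\ q / (2 * lmin) < mu /\ mu * Lmax A < 1) ->
  strict_local_min (Tobj A y lam q) xs.
Proof.
move=> _ lam0 q0 q1 mu0 _ GA xxs I lmin e cond.
have st := GAITA_limit_stationary lam0 q0 q1 mu0 GA xxs.
have q1' : 0 < 1 - q by rewrite subr_gt0.
apply: stationary_strict_local_min => // j; first exact: (st j).1.
move=> xj; have p0 : 0 < powR `|xs j 0| q by rewrite powR_gt0// normr_gt0.
rewrite -/I -/lmin; case: cond => [[l0 lamlt]|[lL [qmu _]]].
- have /andP[e0 ex] := min_abs_supp_le xj.
  (* Cancelling [|xs_j|^q] leaves [lam q (1 - q) < lmin |xs_j|^(2 - q)], which follows from (a) as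
     [e <= |xs_j|]. *)
  have -> : xs j 0 ^+ 2 = powR `|xs j 0| (2 - q) * powR `|xs j 0| q.
    rewrite -powRD; last by rewrite normr_eq0 xj implybT.
    by rewrite subrK powR_mulrn// real_normK ?num_real.
  rewrite mulrA ltr_pM2r// -mulrA -ltr_pdivlMr ?mulr_gt0//.
  apply: lt_le_trans lamlt _.
  rewrite ler_pM2r ?invr_gt0 ?mulr_gt0// ler_pM2l//.
  have q2 : 0 <= 2 - q by lra.
  exact: (ge0_ler_powR q2 e0 (normr_ge0 _) ex).
- have L0 : 0 <= Lmax A by exact: bigmax_ge_id.
  have l0 : 0 < lmin by apply: le_lt_trans lL; rewrite !mulr_ge0 ?invr_ge0// ltW.
  (* The limit lower bound times [lmin] reduces the goal to [q < 2 mu lmin], the lower bound on [mu]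
     in (b). *)
  apply: lt_le_trans (ler_wpM2l (ltW l0) (st j).2).
  move: qmu; rewrite ltr_pdivrMr ?mulr_gt0// => qmu.
  have lp : 0 < lam * (1 - q) * powR `|xs j 0| q by rewrite !mulr_gt0.
  have := qmu; rewrite -(ltr_pM2r lp q); lra.
Qed.
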